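(* For all integers $n \geq 2$, \[ P(n) \geq f(n) + \min\Big\{Q(g(n)),\ \sqrt{2(g(n)+f(n)+1)} + 3/2,\ f(n) - 2\Big\} \] and \[ Q(n) \geq 1 + f(n) + \min\Big\{P(g(n)),\ \sqrt{2(g(n)+f(n)+1)} + 1/2\Big\}. \]
   Context: For $A \subseteq \{0,1,2,\ldots\}$, $\partial A = \{z \in A : \{z-1,z+1\} \not\subseteq A\}$, $vol(A)=\sum_{z\in A} z$, $per(A) = \sum_{z \in \partial A} z$ (both $0$ for the empty set), and $A^c = \{0,1,2,\ldots\}\setminus A$. For integers $n\ge 0$, $P(n) = \min\{per(A) : A \subseteq \{0,1,\ldots\},\ vol(A)=n\}$ and $Q(n) = \min\{per(A^c) : A \subseteq \{0,1,\ldots\},\ vol(A) = n\}$. Also $f(n) = \lceil (-1+\sqrt{1+8n})/2 \rceil$ and $g(n) = f(n)(f(n)+1)/2 - n$. *)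

(* Defs.v *)
From HB Require Import structures.
From mathcomp Require Import all_boot all_order all_algebra.
From mathcomp Require Import all_classical all_reals all_analysis.
From mathcomp Require Import ring lra zify.

Set Implicit Arguments.
Unset Strict Implicit.
Unset Printing Implicit Defensive.

Import Order.TTheory GRing.Theory Num.Theory.

Local Open Scope classical_set_scope.
Local Open Scope ring_scope.

(* 0 has no predecessor in the ambient set, hence the test [0 < z], which     *)
(* guards the truncated [z.-1].                                               *)
Definition boundary (A : set nat) : set nat :=
  [set z | A z /\ ~ [/\ (0 < z)%N, A z.-1 & A z.+1]].

(* [A] ranges over all sets of naturals: the sums live in the extended reals, *)
(* so that an infinite [A] has volume +oo.                                    *)
Definition vol (R : realType) (A : set nat) : \bar R :=
  \esum_(z in A) (z%:R)%:E.

Definition per (R : realType) (A : set nat) : \bar R :=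
  \esum_(z in boundary A) (z%:R)%:E.

Lemma esum_nat_finite (R : realType) (S : set nat) : finite_set S ->
  exists k : nat, (\esum_(z in S) (z%:R)%:E = (k%:R)%:E :> \bar R)%E.
Proof.
move=> fS; rewrite esum_fset //.
by rewrite fsbig_finite // sumEFin -natr_sum; eexists.
Qed.

Lemma vol_set1 (R : realType) (n : nat) : vol R [set n] = (n%:R)%:E.
Proof. by rewrite /vol esum_set1 // lee_fin. Qed.

Lemma P_ex (R : realType) (n : nat) : exists k : nat,
  `[< exists A : set nat, vol R A = (n%:R)%:E /\ per R A = (k%:R)%:E >].
Proof.
have [|k Hk] := @esum_nat_finite R (boundary [set n]).
  by apply: (sub_finite_set _ (finite_set1 n)) => z [].
by exists k; apply/asboolP; exists [set n]; split=> //; exact: vol_set1.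
Qed.

Lemma Q_ex (R : realType) (n : nat) : exists k : nat,
  `[< exists A : set nat, vol R A = (n%:R)%:E /\ per R (~` A) = (k%:R)%:E >].
Proof.
have [|k Hk] := @esum_nat_finite R (boundary (~` [set n])).
  apply: (sub_finite_set _ (finite_II n.+2)) => z [/= zn Hz].
  rewrite ltnNge; apply/negP => nz; apply: Hz.
  by split; rewrite /setC /=; lia.
by exists k; apply/asboolP; exists [set n]; split=> //; exact: vol_set1.
Qed.

(* A set of finite volume is finite, so the perimeters over which the minima  *)
(* are taken are natural numbers; [ex_minn] picks the least one.              *)
Definition P (R : realType) (n : nat) : nat := ex_minn (P_ex R n).

Definition Q (R : realType) (n : nat) : nat := ex_minn (Q_ex R n).

(* The ceiling is nonnegative, so [absz] only changes its type, see [fE].     *)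
Definition f (R : realType) (n : nat) : nat :=
  `|Num.ceil ((-1 + Num.sqrt (1 + 8 * n%:R)) / 2 : R)|%N.

(* Neither the division nor the subtraction truncates, see [gE].              *)
Definition g (R : realType) (n : nat) : nat :=
  ((f R n * (f R n).+1) %/ 2 - n)%N.

Lemma fE (R : realType) (n : nat) :
  (f R n)%:Z = Num.ceil ((-1 + Num.sqrt (1 + 8 * n%:R)) / 2 : R).
Proof.
rewrite /f gez0_abs // -(ceil0 R); apply: le_ceil.
have : Num.sqrt 1 <= Num.sqrt (1 + 8 * n%:R) :> R.
  by apply: ler_wsqrtr; rewrite lerDl mulr_ge0.
rewrite sqrtr1; lra.
Qed.

Lemma gE (R : realType) (n : nat) :
  (g R n)%:R = (f R n)%:R * ((f R n)%:R + 1) / 2 - n%:R :> R.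
Proof.
have Hf : (-1 + Num.sqrt (1 + 8 * n%:R)) / 2 <= (f R n)%:R :> R.
  by apply: le_trans (ceil_ge _) _; rewrite -fE.
have Hs : Num.sqrt (1 + 8 * n%:R) ^+ 2 = 1 + 8 * n%:R :> R.
  by rewrite sqr_sqrtr // addr_ge0 // mulr_ge0.
have s0 : 0 <= Num.sqrt (1 + 8 * n%:R) :> R by exact: sqrtr_ge0.
have E2 : ((f R n * (f R n).+1) %/ 2)%:R
    = (f R n)%:R * ((f R n)%:R + 1) / 2 :> R.
  have H : (((f R n * (f R n).+1) %/ 2) * 2 = f R n * (f R n).+1)%N.
    by apply/eqP; rewrite -dvdn_eq dvdn2 oddM /= andbN.
  by rewrite natr1 -natrM -H natrM mulfK // mulnK.
have : (n%:R <= ((f R n * (f R n).+1) %/ 2)%:R :> R) by rewrite E2; nra.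
by rewrite ler_nat => le; rewrite /g natrB // E2.
Qed.

(* Main.v *)
(* Let A be optimal for n, m = max A and B = {0..m} \ A. As vol A = n, m is   *)
(* at least f = f(n). If m = f, then vol B = g(n), and besides the top point  *)
(* f (resp. f + 1) the boundary of A (resp. A^c) is that of B^c (resp. B).    *)
(* If m > f, then vol B >= g(n) + f + 1 forces                                *)
(* b = max B >= sqrt(2 (g(n) + f + 1)) - 1/2, and b + 1 (resp. b) is a second *)
(* boundary point besides m (resp. m + 1). For P this requires m - 1 in A;    *)
(* otherwise, with c the largest element of A below m (0 if there is none),   *)
(* n <= m + c (c + 1) / 2 gives m + c >= 2 f - 2.                             *)
Require Import Defs.
From HB Require Import structures.
From mathcomp Require Import all_boot all_order all_algebra.
From mathcomp Require Import all_classical all_reals all_analysis.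
From mathcomp Require Import lra zify.

Import Order.TTheory GRing.Theory Num.Theory.
Local Open Scope ring_scope.

(** A set of volume [n] lies in [{0..n}], so every volume and perimeter here is a finite sum [nsum].
    The number [f n] is the least [k] whose triangular number reaches [n], and [g n] is the excess,
    so an optimal [A] has maximum [m >= f n]. Complementation in [{0..m}] nearly exchanges the
    boundaries of [A] and its complement: when [m = f n] it leads to the other problem at volume
    [g n], and when [m > f n] the complement is so heavy that its largest element yields a second
    large boundary point. [per_cases] and [perC_cases] carry this out; each alternative matches one
    term of a minimum in [theorem16]. *)

(** * Weighted sums over a finite window *)

Definition nsum (N : nat) (S : set nat) : nat :=
  (\sum_(0 <= z < N | z \in S) z)%N.

Lemma esum_nsum (R : realType) (N : nat) (S : set nat) :
  (forall z, S z -> (z < N)%N) ->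
  \esum_(z in S) (z%:R)%:E = ((nsum N S)%:R)%:E :> \bar R.
Proof.
move=> SN.
have fS : finite_set S by apply: sub_finite_set (finite_II N) => z /SN.
rewrite esum_fset // (fsbigE [seq z <- index_iota 0 N | z \in S]).
- rewrite big_filter_cond sumEFin /nsum natr_sum.
  by congr (_%:E); apply: eq_bigl => z; rewrite andbb.
- by rewrite filter_uniq // iota_uniq.
- by move=> z /=; rewrite mem_filter => /andP[/set_mem].
- by move=> z Sz; rewrite mem_filter mem_index_iota (mem_set Sz) SN.
Qed.

(* The element 0 weighs nothing, hence the guard [0 < z] here and below. *)
Lemma leq_nsum_setU1 (N x : nat) (S T : set nat) :
  (forall z, (0 < z)%N -> T z -> z = x \/ S z) ->
  (nsum N T <= x + nsum N S)%N.
Proof.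
move=> TS; rewrite /nsum [X in (X <= _)%N]big_mkcond [X in (_ + X)%N]big_mkcond /=.
have H z : ((if z \in T then z else 0) <=
    (if z == x then x else 0) + (if z \in S then z else 0))%N.
  case: ifPn => // /set_mem Tz; case: (posnP z) => [->//|z0].
  have [->|/mem_set ->] := TS _ z0 Tz; first by rewrite eqxx leq_addr.
  by rewrite leq_addl.
apply: leq_trans (leq_sum _ (fun z _ => H z)) _.
rewrite big_split leq_add2r -big_mkcond big_nat1_eq.
by case: ifP.
Qed.

Lemma nsum_setU1_leq (N x : nat) (S T : set nat) : (x < N)%N ->
  T x -> ~ S x -> (forall z, (0 < z)%N -> S z -> T z) ->
  (x + nsum N S <= nsum N T)%N.
Proof.
move=> xN Tx Sx ST.
rewrite /nsum [X in (_ <= X)%N]big_mkcond /=.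
rewrite [X in (_ <= X)%N](bigD1_seq x) ?iota_uniq ?mem_index_iota //=.
rewrite (mem_set Tx) leq_add2l big_mkcond [X in (_ <= X)%N]big_mkcond /=.
apply: leq_sum => z _; case: ifPn => // /set_mem Sz.
case: (posnP z) => [->//|z0].
rewrite (mem_set (ST _ z0 Sz)) /=.
by case: eqP => // zx; case: Sx; rewrite -zx.
Qed.

Lemma nsum_set0 (N : nat) (S : set nat) : (forall z, (0 < z)%N -> ~ S z) ->
  nsum N S = 0%N.
Proof.
move=> S0; rewrite /nsum big1 // => z /set_mem Sz.
by case: (posnP z) => [//|z0]; case: (S0 z z0).
Qed.

Lemma nsum_set1 (N c : nat) : (c < N)%N -> nsum N [set c] = c.
Proof.
move=> cN; have n0 : nsum N set0 = 0%N by apply: nsum_set0 => z _ [].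
have le : (nsum N [set c] <= c + nsum N set0)%N.
  by apply: leq_nsum_setU1 => z _ ->; left.
have ge : (c + nsum N set0 <= nsum N [set c])%N by exact: nsum_setU1_leq.
by move: le ge; rewrite n0 addn0; lia.
Qed.

Lemma nsum_le (N m : nat) : (m < N)%N ->
  (2 * nsum N [set z | (z <= m)%N] = m * m.+1)%N.
Proof.
elim: m => [|m IH] mN.
  by rewrite nsum_set0 // => z /= z0; apply/negP; rewrite -ltnNge.
have -> : nsum N [set z | (z <= m.+1)%N] = (m.+1 + nsum N [set z | (z <= m)%N])%N.
  apply/eqP; rewrite eqn_leq leq_nsum_setU1 ?nsum_setU1_leq //=.
  - by rewrite ltnn.
  - by move=> z _ /leqW.
  - by move=> z _; rewrite leq_eqVlt ltnS => /orP[/eqP|]; [left|right].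
by rewrite mulnDr IH 1?ltnW //; lia.
Qed.

Lemma nsum_setC (N m : nat) (A : set nat) : (m < N)%N ->
  (forall z, A z -> (z <= m)%N) ->
  (2 * (nsum N A + nsum N [set z | (z <= m)%N /\ ~ A z]) = m * m.+1)%N.
Proof.
move=> mN Am; rewrite -(nsum_le _ _ mN); congr (2 * _)%N.
rewrite /nsum [RHS](bigID (fun z => z \in A)) /=; congr (_ + _)%N;
  apply: eq_bigl => z; apply/idP/idP.
- by move=> /[dup] zA ->; rewrite andbT; apply/mem_set/Am/set_mem.
- by case/andP.
- move=> /set_mem[zm zA]; apply/andP; split; first exact: mem_set.
  by apply/negP => /set_mem.
- move=> /andP[/set_mem zm /negP zA]; apply/mem_set; split=> // /mem_set.
  exact: zA.
Qed.

Lemma nsum_leq_tri (N m : nat) (A : set nat) : (m < N)%N ->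
  (forall z, A z -> (z <= m)%N) -> (2 * nsum N A <= m * m.+1)%N.
Proof. by move=> mN Am; rewrite -(nsum_setC _ _ _ mN Am); lia. Qed.

Lemma set_nat_max (N x : nat) (S : set nat) :
  (forall z, S z -> (z < N)%N) -> S x ->
  exists m, S m /\ forall z, S z -> (z <= m)%N.
Proof.
move=> SN Sx; have ex : exists z, z \in S by exists x; exact: mem_set.
have ub z : z \in S -> (z <= N)%N by move=> /set_mem /SN /ltnW.
case: (ex_maxnP ex ub) => m /set_mem Sm max_m.
by exists m; split=> // z /mem_set /max_m.
Qed.

(** * Case analysis on the largest element *)

(** Here [k] and [h] stand for [f n] and [g n]. The split is on whether [m.-1] lies in [A], then on
    whether [m = k]. *)
Lemma per_cases (N n k h : nat) (A : set nat) :
  (0 < n)%N -> (n.+1 < N)%N -> (forall z, A z -> (z <= n)%N) -> nsum N A = n ->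
  (k * k.-1 < 2 * n)%N -> (2 * n + 2 * h = k * k.+1)%N ->
  [\/ exists B, [/\ forall z, B z -> (z <= n)%N, nsum N B = h &
        (k + nsum N (boundary (~` B)) <= nsum N (boundary A))%N],
      (k + (k - 2) <= nsum N (boundary A))%N |
      exists b, (2 * (h + k + 1) <= b * b.+1)%N /\
        (k + (b + 2) <= nsum N (boundary A))%N].
Proof.
move=> n0 nN An volA kn nk.
have [x Ax] : exists x, A x.
  apply: contrapT => H; move: n0; rewrite -volA nsum_set0 // => z _ Az.
  by apply: H; exists z.
have [|m [Am max_m]] := set_nat_max n.+1 x A _ Ax; first by move=> z /An.
have mN : (m < N)%N by have := An _ Am; lia.
(* [k * k.-1 < 2 * n <= m * m.+1] excludes [m < k]. *)
have mk : (k <= m)%N by have := nsum_leq_tri _ _ _ mN max_m; nia.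
have bAm : boundary A m by split=> // -[_ _ /max_m]; rewrite ltnn.
have per2 c : (c < m)%N -> ((0 < c)%N -> boundary A c) ->
    (m + c <= nsum N (boundary A))%N.
  move=> cm bAc; rewrite -{1}(nsum_set1 N c); last by lia.
  apply: nsum_setU1_leq => //=; first by lia.
  by move=> z z0 zc; rewrite zc in z0 *; exact: bAc.
have [Am1|Am1] := pselect (A m.-1); last first.
  (* Adding the weightless 0 gives [C] a maximum even if [A] is just [{m}]. *)
  apply: Or32; pose C := [set z : nat | z = 0%N \/ A z /\ (z < m)%N]%classic.
  have m0 : (0 < m)%N.
    case: (posnP m) => // m0; have := nsum_leq_tri _ _ _ mN max_m; lia.
  have [||c [Cc max_c]] := set_nat_max m 0 C; [by move=> z [->|[]]|by left|].
  have cm : (c < m)%N by case: Cc => [->|[]].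
  have cm1 : (0 < c)%N -> (c.+1 < m)%N.
    case: Cc => [->//|[Ac _] _]; rewrite ltn_neqAle cm andbT.
    by apply/eqP => cm1; apply: Am1; rewrite -cm1.
  have bAc : (0 < c)%N -> boundary A c.
    move=> c0; case: Cc => [c00|[Ac _]]; first by rewrite c00 in c0.
    split=> // -[_ _ Ac1]; have := max_c c.+1 (or_intror (conj Ac1 (cm1 c0))).
    by rewrite ltnn.
  apply: leq_trans (per2 c cm bAc).
  have vol_le : (2 * n <= 2 * m + c * c.+1)%N.
    rewrite -(nsum_le N c); last by lia.
    rewrite -mulnDr leq_mul2l -volA leq_nsum_setU1 // => z _ Az.
    have := max_m _ Az; rewrite leq_eqVlt => /orP[/eqP|zm]; first by left.
    by right; apply: max_c; right.
  (* If [m + c <= 2k - 3], then [c <= k - 3] as [m >= k], so [2m + c(c+1) <= 4k - 6 + c(c-1) <= k^2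
     - 3k + 6]. This is at most [k(k-1)] because [k >= 3], against [k(k-1) < 2n]. *)
  nia.
pose B := [set z | (z <= m)%N /\ ~ A z]%classic.
have volB : (2 * (n + nsum N B) = m * m.+1)%N.
  by rewrite -{1}volA; exact: nsum_setC.
have m0 : (0 < m)%N by nia.
have AB z : A z -> (~` B)%classic z by move=> Az [].
have [mk1|mk1] := eqVneq m k.
  apply: Or31; exists B; split.
  - by move=> z [zm _]; have := An _ Am; lia.
  - by move: volB; rewrite mk1; lia.
  (* The point [m] is new: [m.-1], [m] and [m.+1] all avoid [B], so [m] is interior to its
     complement. *)
  rewrite -mk1; apply: nsum_setU1_leq => //.
    by move=> [_]; apply; split; [|exact: AB|move=> []; rewrite ltnn].
  move=> z z0 [nBz nb].
  have zm : (z <= m)%N.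
    rewrite leqNgt; apply/negP => mz; apply: nb; split=> //; last first.
      by move=> []; lia.
    by move=> [zm nA]; apply: nA; have -> : z.-1 = m by lia.
  split; first by apply: contrapT => nAz; apply: nBz.
  by move=> [_ Az1 Az2]; apply: nb; split => //; exact: AB.
apply: Or33.
have [x' Bx'] : exists x, B x.
  apply: contrapT => H; have : nsum N B = 0%N.
    by apply: nsum_set0 => z _ Bz; apply: H; exists z.
  (* From [m >= k + 1], twice the weight of [B] is at least [(k+1)(k+2) - 2n = 2(h+k+1)]; the same
     bound gives the estimate on [b] below. *)
  nia.
have [|b [Bb max_b]] := set_nat_max m.+1 x' B _ Bx'; first by move=> z [].
have bm : (b.+1 < m)%N.
  case: Bb => bm nAb; rewrite ltnNge; apply/negP => mb.
  have [bE|bE] : b = m \/ b = m.-1 by lia.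
    by rewrite bE in nAb.
  by rewrite bE in nAb.
exists b; split.
  have := nsum_leq_tri N b B; rewrite -/B; have bN : (b < N)%N by lia.
  by move=> /(_ bN max_b); nia.
have Ab1 : A b.+1.
  apply: contrapT => nA; have := max_b b.+1 (conj (ltnW bm) nA).
  by rewrite ltnn.
(* The boundary points [m >= k + 1] and [b + 1] together weigh at least [k + b + 2]. *)
apply: leq_trans (per2 b.+1 bm _); first by lia.
by move=> _; split=> // -[_ Ab _]; case: Bb.
Qed.

(** The top boundary point of the complement is always [m.+1], and [b] itself is a boundary point
    since [b.+1] is in [A]; hence no case on [m.-1] arises. *)
Lemma perC_cases (N n k h : nat) (A : set nat) :
  (0 < n)%N -> (n.+1 < N)%N -> (forall z, A z -> (z <= n)%N) -> nsum N A = n ->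
  (k * k.-1 < 2 * n)%N -> (2 * n + 2 * h = k * k.+1)%N ->
  (exists B, [/\ forall z, B z -> (z <= n)%N, nsum N B = h &
     (k + 1 + nsum N (boundary B) <= nsum N (boundary (~` A)))%N]) \/
  exists b, (2 * (h + k + 1) <= b * b.+1)%N /\
     (k + 2 + b <= nsum N (boundary (~` A)))%N.
Proof.
move=> n0 nN An volA kn nk.
have [x Ax] : exists x, A x.
  apply: contrapT => H; move: n0; rewrite -volA nsum_set0 // => z _ Az.
  by apply: H; exists z.
have [|m [Am max_m]] := set_nat_max n.+1 x A _ Ax; first by move=> z /An.
have mn := An _ Am; have mN : (m.+1 < N)%N by lia.
have mk : (k <= m)%N by have := nsum_leq_tri _ _ _ (ltnW mN) max_m; nia.
have nAm1 : ~ A m.+1 by move=> /max_m; rewrite ltnn.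
have bAm : boundary (~` A) m.+1 by split=> // -[_ /= nA _].
pose B := [set z | (z <= m)%N /\ ~ A z]%classic.
have volB : (2 * (n + nsum N B) = m * m.+1)%N.
  by rewrite -{1}volA; apply: nsum_setC => //; exact: ltnW.
have [mk1|mk1] := eqVneq m k.
  left; exists B; split.
  - by move=> z [zm _]; lia.
  - by move: volB; rewrite mk1; lia.
  rewrite -mk1 addn1; apply: nsum_setU1_leq => //.
    by move=> [[]]; rewrite ltnn.
  move=> z z0 [[zm nAz] nb]; split=> // -[_ nA1 nA2]; apply: nb; split=> //.
    by split=> //; lia.
  split=> //; rewrite ltn_neqAle zm andbT; apply/eqP => zE.
  by apply: nAz; rewrite zE.
right.
have [x' Bx'] : exists x, B x.
  apply: contrapT => H; have : nsum N B = 0%N.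
    by apply: nsum_set0 => z _ Bz; apply: H; exists z.
  nia.
have [|b [Bb max_b]] := set_nat_max m.+1 x' B _ Bx'; first by move=> z [].
have bm : (b < m)%N.
  case: Bb => bm nAb; rewrite ltn_neqAle bm andbT; apply/eqP => bE.
  by apply: nAb; rewrite bE.
exists b; split.
  by have := nsum_leq_tri N b B (ltn_trans bm (ltnW mN)) max_b; nia.
have Ab1 : A b.+1.
  by apply: contrapT => nA; have := max_b b.+1 (conj bm nA); rewrite ltnn.
apply: (@leq_trans (m.+1 + b)); first by lia.
rewrite -{1}(nsum_set1 N b); last by lia.
apply: nsum_setU1_leq => //=; first by move=> /= bE; lia.
by move=> z z0 ->; case: Bb => _ nAb; split=> // -[].
Qed.

(** * From extended-real sums to finite ones *)

(** Weights are nonnegative, so one element never exceeds the total. *)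
Lemma volP (R : realType) (n : nat) (A : set nat) :
  vol R A = (n%:R)%:E -> forall z, A z -> (z <= n)%N.
Proof.
move=> volA z Az; rewrite -(ler_nat R) -lee_fin -volA.
apply: esum_ge; exists [set z]%classic; last by rewrite fsbig_set1.
by split; [exact: finite_set1|move=> _ ->].
Qed.

Lemma boundary_sub (A : set nat) (z : nat) : boundary A z -> A z.
Proof. by case. Qed.

Lemma boundaryC_leq (m z : nat) (A : set nat) :
  (forall y, A y -> (y <= m)%N) -> boundary (~` A) z -> (z <= m.+1)%N.
Proof.
move=> Am [nAz nb]; rewrite leqNgt; apply/negP => mz; apply: nb.
by split; [lia|move=> /Am; lia|move=> /Am; lia].
Qed.

Lemma P_witness (R : realType) (n : nat) : exists A : set nat,
  vol R A = (n%:R)%:E /\ per R A = ((P R n)%:R)%:E.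
Proof. by rewrite /P; case: ex_minnP => k /asboolP. Qed.

Lemma P_leq (R : realType) (n k : nat) (A : set nat) :
  vol R A = (n%:R)%:E -> per R A = (k%:R)%:E -> (P R n <= k)%N.
Proof.
by move=> volA perA; rewrite /P; case: ex_minnP => j _; apply; apply/asboolP; exists A.
Qed.

Lemma Q_witness (R : realType) (n : nat) : exists A : set nat,
  vol R A = (n%:R)%:E /\ per R (~` A) = ((Q R n)%:R)%:E.
Proof. by rewrite /Q; case: ex_minnP => k /asboolP. Qed.

Lemma Q_leq (R : realType) (n k : nat) (A : set nat) :
  vol R A = (n%:R)%:E -> per R (~` A) = (k%:R)%:E -> (Q R n <= k)%N.
Proof.
by move=> volA perA; rewrite /Q; case: ex_minnP => j _; apply; apply/asboolP; exists A.
Qed.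

Lemma esum_nsum_eq (R : realType) (N k : nat) (S : set nat) :
  (forall z, S z -> (z < N)%N) ->
  \esum_(z in S) (z%:R)%:E = (k%:R)%:E :> \bar R -> nsum N S = k.
Proof. by move=> SN; rewrite (esum_nsum _ _ _ SN) => -[/eqP]; rewrite eqr_nat => /eqP. Qed.

(** * Arithmetic of [f], [g] and the square root *)

(** With [f n = k + 1], the ceiling gives [2k + 1 < sqrt(1 + 8n)]; squaring gives [k(k+1) < 2n]. *)
Lemma f_tri_gt (R : realType) (n : nat) : (0 < n)%N ->
  (f R n * (f R n).-1 < 2 * n)%N.
Proof.
move=> n0; case E : (f R n) => [|k]; first by rewrite mul0n; lia.
have := ceilB1_lt ((-1 + Num.sqrt (1 + 8 * n%:R)) / 2 : R).
rewrite -fE E (_ : k.+1%:Z - 1 = k%:Z) -?pmulrn => [H|]; last by lia.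
have s2 : Num.sqrt (1 + 8 * n%:R) ^+ 2 = 1 + 8 * n%:R :> R.
  by rewrite sqr_sqrtr // addr_ge0 // mulr_ge0.
have k0 : 0 <= k%:R :> R by [].
have k1 : k.+1%:R = k%:R + 1 :> R by rewrite natr1.
rewrite -(ltr_nat R) !natrM /= k1; nra.
Qed.

Lemma g_tri (R : realType) (n : nat) :
  (2 * n + 2 * g R n = f R n * (f R n).+1)%N.
Proof.
apply/eqP; rewrite -(eqr_nat R) natrD !natrM gE -[(f R n).+1%:R]natr1; apply/eqP; lra.
Qed.

(** Completing the square: [b(b+1) <= (b + 1/2)^2]. *)
Lemma sqrt_double_le (R : realType) (v b : nat) : (2 * v <= b * b.+1)%N ->
  Num.sqrt (2 * v%:R) <= b%:R + 1 / 2 :> R.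
Proof.
rewrite -(ler_nat R) !natrM -[b.+1%:R]natr1 => H.
have b0 : 0 <= b%:R :> R by [].
rewrite -[leRHS]ger0_norm; last by lra.
by rewrite -sqrtr_sqr; apply: ler_wsqrtr; nra.
Qed.

Theorem theorem16 (R : realType) (n : nat) (hn : (2 <= n)%N) :
  ((P R n)%:R >= (f R n)%:R +
     Num.min (Q R (g R n))%:R
       (Num.min (Num.sqrt (2 * ((g R n)%:R + (f R n)%:R + 1)) + 3 / 2)
                ((f R n)%:R - 2)) :> R)
  /\
  ((Q R n)%:R >= 1 + (f R n)%:R +
     Num.min (P R (g R n))%:R
       (Num.sqrt (2 * ((g R n)%:R + (f R n)%:R + 1)) + 1 / 2) :> R).
Proof.
have n0 : (0 < n)%N by lia.
(* The window [n.+2] is used because the boundary of the complement can reach [n.+1]. *)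
have nN : (n.+1 < n.+2)%N by [].
have fn := f_tri_gt R n n0; have gn := g_tri R n.
have -> : (g R n)%:R + (f R n)%:R + 1 = (g R n + f R n + 1)%N%:R :> R.
  by rewrite !natrD.
have volE S h : (forall z, S z -> (z <= n)%N) -> nsum n.+2 S = h ->
    vol R S = (h%:R)%:E.
  by move=> Sn <-; apply: esum_nsum => z /Sn; lia.
have perE S : (forall z, S z -> (z <= n)%N) ->
    per R S = ((nsum n.+2 (boundary S))%:R)%:E.
  by move=> Sn; apply: esum_nsum => z /boundary_sub /Sn; lia.
have perCE S : (forall z, S z -> (z <= n)%N) ->
    per R (~` S) = ((nsum n.+2 (boundary (~` S)))%:R)%:E.
  by move=> Sn; apply: esum_nsum => z /(boundaryC_leq _ _ _ Sn).
split.
- have [A [volA perA]] := P_witness R n; have An := volP _ _ _ volA.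
  have vA : nsum n.+2 A = n by apply: esum_nsum_eq volA => z /An; lia.
  have pA : nsum n.+2 (boundary A) = P R n.
    by apply: esum_nsum_eq perA => z /boundary_sub /An; lia.
  have [[B [Bn vB]]||[b [/(sqrt_double_le R) bv]]] :=
    per_cases _ _ _ _ _ n0 nN An vA fn gn; rewrite pA.
  + have QB := Q_leq _ _ _ _ (volE _ _ Bn vB) (perCE _ Bn).
    move=> le; apply: (@le_trans _ _ ((f R n)%:R + (Q R (g R n))%:R)).
      by rewrite lerD2l ge_min lexx.
    by rewrite -natrD ler_nat; lia.
  + move=> le; apply: (@le_trans _ _ ((f R n)%:R + ((f R n)%:R - 2))).
      by rewrite lerD2l !ge_min lexx !orbT.
    have : (2 * f R n <= P R n + 2)%N by lia.
    by rewrite -(ler_nat R) natrD natrM; lra.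
  + rewrite -(ler_nat R) !natrD => le.
    apply: le_trans le; rewrite lerD2l !ge_min; apply/orP; right.
    by apply/orP; left; rewrite -!natrD; move: bv; rewrite !natrD; lra.
- have [A [volA perA]] := Q_witness R n; have An := volP _ _ _ volA.
  have vA : nsum n.+2 A = n by apply: esum_nsum_eq volA => z /An; lia.
  have pA : nsum n.+2 (boundary (~` A)) = Q R n.
    by apply: esum_nsum_eq perA => z /(boundaryC_leq _ _ _ An).
  have [[B [Bn vB]]|[b [/(sqrt_double_le R) bv]]] :=
    perC_cases _ _ _ _ _ n0 nN An vA fn gn; rewrite pA.
  + have PB := P_leq _ _ _ _ (volE _ _ Bn vB) (perE _ Bn).
    move=> le; apply: (@le_trans _ _ (1 + (f R n)%:R + (P R (g R n))%:R)).
      by rewrite lerD2l ge_min lexx.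
    by rewrite [1 + _]addrC natr1 -natrD ler_nat; lia.
  + rewrite -(ler_nat R) !natrD => le.
    apply: le_trans le.
    apply: (@le_trans _ _ (1 + (f R n)%:R + (b%:R + 1))); last by lra.
    rewrite lerD2l ge_min; apply/orP; right; move: bv; rewrite !natrD; lra.
Qed.
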